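(* Let $Y$ be a nonempty subset of $\mathrm{GL}(n,q)$ with dual distance distribution $(A'_k)_{0\le k\le n}$ and let $t$ be an integer satisfying $1\le t\le n$. If $Y$ is a $t$-design, then $A'_k=0$ for all $k$ satisfying $1\le k\le t$. Moreover the converse also holds if $t\le n/2$: if $t\le n/2$ and $A'_k=0$ for all $k$ satisfying $1\le k\le t$, then $Y$ is a $t$-design.
   Context: $n\ge1$ and $q$ is a prime power. A $t$-design in $\mathrm{GL}(n,q)$ is a subset $Y$ that is transitive on $t$-tuples of linearly independent vectors of $\mathbb{F}_q^n$: there is a constant $r$ such that for any two linearly independent $t$-tuples $(v_i)$, $(v_i')$ exactly $r$ elements $g\in Y$ satisfy $gv_i=v_i'$ for all $i$. The distance distribution of a nonempty $Y$ is $A_i=\frac1{|Y|}\,|\{(x,y)\in Y\times Y:\operatorname{rk}(x-y)=i\}|$, $0\le i\le n$, and the dual distance distribution is $A'_k=\sum_{i=0}^nU_k(q^{n-i})A_i$, $0\le k\le n$, where \[ U_k(x)=\sum_{j=0}^k(-1)^{k-j}q^{\binom{k-j}{2}}{k\brack j}_q\prod_{i=0}^{j-1}(x-q^i) \] are the Al-Salam-Carlitz polynomials (parameter $a=1$) and ${k\brack j}_q$ is the $q$-binomial coefficient. *)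

(* Defs.v *)
From HB Require Import structures.
From mathcomp Require Import all_boot all_order all_algebra.

Set Implicit Arguments.
Unset Strict Implicit.
Unset Printing Implicit Defensive.

Import Order.TTheory GRing.Theory Num.Theory.

Local Open Scope ring_scope.

(* The finite field F_q is an arbitrary F : finFieldType with q = #|F|, and
   GL(n, q) is the set unitmx of invertible matrices in 'M[F]_n; it acts on
   column vectors by left multiplication. *)

Definition is_design (F : finFieldType) (n t : nat) (Y : {set 'M[F]_n}) : Prop :=
  exists r : nat, forall v w : t.-tuple 'cV[F]_n, free v -> free w ->
    #|[set g in Y | [forall i, g *m tnth v i == tnth w i]]| = r.

(* The denominators are nonzero when 1 < q, and the product vanishes
   for k < j. *)
Definition qbinom (q k j : nat) : rat :=
  \prod_(i < j) ((q%:R ^+ k - q%:R ^+ i) / (q%:R ^+ j - q%:R ^+ i)).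

Definition alSalamCarlitz (q k : nat) : {poly rat} :=
  \sum_(j < k.+1)
     ((-1) ^+ (k - j) * q%:R ^+ 'C(k - j, 2) * qbinom q k j)
       *: \prod_(i < j) ('X - (q%:R ^+ i)%:P).

Definition distance_distribution (F : finFieldType) (n : nat)
    (Y : {set 'M[F]_n}) (i : nat) : rat :=
  #|[set p in setX Y Y | \rank (p.1 - p.2) == i]|%:R / #|Y|%:R.

Definition dual_distance_distribution (F : finFieldType) (n : nat)
    (Y : {set 'M[F]_n}) (k : nat) : rat :=
  \sum_(i < n.+1)
     (alSalamCarlitz #|F| k).[#|F|%:R ^+ (n - i)] * distance_distribution Y i.

(* Main.v *)
(** Let f_j be the number of triples (x, y, v) with x, y in Y and v a linearly
    independent j-tuple such that x v = y v. Since x and y agree exactly on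
    ker (x - y), the product \prod_(i < j) (q^(n-i') - q^i) at i' = rk (x - y)
    counts such v, so |Y| A'_k = \sum_j c_kj f_j, where the c_kj are the
    coefficients of U_k. The matrix (c_kj) is unitriangular and, by the
    q-binomial theorem, its rows with k >= 1 sum to 0; hence A'_1 = ... = A'_t = 0
    if and only if f_1 = ... = f_t = f_0 = |Y|^2.

    On the other hand f_j is the second moment of the numbers N(v, w) of g in Y
    mapping v to w, whose mean is |Y| / I with I the number of linearly
    independent j-tuples. So f_j = |Y|^2 says that the variance of N vanishes,
    i.e. that Y is a j-design; and t-designs are j-designs for j <= t. *)

Require Import Defs.
From HB Require Import structures.
From mathcomp Require Import all_boot all_order all_algebra.
From mathcomp Require Import finfield mxabelem ring.

Set Implicit Arguments.
Unset Strict Implicit.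
Unset Printing Implicit Defensive.

Import GRing.Theory Num.Theory.

(** * Coefficients of the Al-Salam-Carlitz polynomials *)

Section AlSalamCarlitzCoefficients.

Local Open Scope ring_scope.

Variable q : nat.
Hypothesis q_gt1 : (1 < q)%N.

Definition alSalamCarlitz_coef (k j : nat) : rat :=
  (-1) ^+ (k - j) * q%:R ^+ 'C(k - j, 2) * qbinom q k j.

Lemma subr_expq_neq0 i j : (i < j)%N -> (q%:R ^+ j - q%:R ^+ i : rat) != 0.
Proof.
move=> lt_ij; rewrite subr_eq0 -!natrX eqr_nat neq_ltn !ltn_exp2l // lt_ij.
by rewrite orbT.
Qed.

Lemma qbinomE k j :
  qbinom q k j = (\prod_(i < j) (q%:R ^+ k - q%:R ^+ i))
                 / \prod_(i < j) (q%:R ^+ j - q%:R ^+ i).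
Proof. by rewrite /qbinom big_split /= prodfV. Qed.

Lemma qbinom0 k : qbinom q k 0 = 1.
Proof. by rewrite /qbinom big_ord0. Qed.

Lemma qbinom_small k j : (k < j)%N -> qbinom q k j = 0.
Proof.
move=> lt_kj; rewrite qbinomE (bigD1 (Ordinal lt_kj)) //=.
by rewrite subrr !mul0r.
Qed.

Lemma qbinomnn k : qbinom q k k = 1.
Proof.
by rewrite qbinomE divff //; apply/prodf_neq0 => i _; exact: subr_expq_neq0.
Qed.

Lemma prod_subX_S k j :
  \prod_(i < j.+1) (q%:R ^+ k.+1 - q%:R ^+ i) =
  (q%:R ^+ k.+1 - 1) * q%:R ^+ j * \prod_(i < j) (q%:R ^+ k - q%:R ^+ i) :> rat.
Proof.
rewrite big_ord_recl expr0 -mulrA; congr (_ * _).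
have -> : q%:R ^+ j = \prod_(i < j) q%:R :> rat.
  by rewrite prodr_const card_ord.
by rewrite -big_split; apply: eq_bigr => i _; rewrite /= mulrBr -!exprS.
Qed.

(** The q-Pascal rule; [j <= k] keeps the subtraction in the exponent exact. *)
Lemma qbinomS k j : (j <= k)%N ->
  qbinom q k.+1 j.+1 = q%:R ^+ (k - j) * qbinom q k j + qbinom q k j.+1.
Proof.
move=> le_jk; rewrite !qbinomE !prod_subX_S big_ord_recr /=.
have D0 : \prod_(i < j) (q%:R ^+ j - q%:R ^+ i) != 0 :> rat.
  by apply/prodf_neq0 => i _; exact: subr_expq_neq0.
have qj0 : q%:R ^+ j != 0 :> rat.
  by rewrite expf_neq0 // pnatr_eq0 -lt0n ltnW.
have qj1 : q%:R ^+ j.+1 - 1 != 0 :> rat.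
  by have /= := @subr_expq_neq0 0 j.+1 isT; rewrite expr0.
rewrite !exprS in qj1 *; have -> : q%:R ^+ k = q%:R ^+ (k - j) * q%:R ^+ j :> rat.
  by rewrite -exprD subnK.
by field; rewrite D0 qj0 qj1.
Qed.

(** The case of the q-binomial theorem whose product has a zero factor. The q-Pascal rule splits the
    sum in two, and the halves cancel because the weights satisfy a (m + 1) = - q^m a m. *)
Lemma sum_alSalamCarlitz_coef k :
  \sum_(j < k.+2) alSalamCarlitz_coef k.+1 j = 0.
Proof.
pose a m : rat := (-1) ^+ m * q%:R ^+ 'C(m, 2).
have aS m : a m.+1 = - (q%:R ^+ m * a m).
  by rewrite /a exprS binS bin1 exprD; ring.
(* Shift the index by one: the term j = 0 comes out as [a k.+1], and the new top term vanishes. *)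
have second : \sum_(j < k.+1) a (k.+1 - j)%N * qbinom q k j =
    a k.+1 + \sum_(j < k.+1) a (k - j)%N * qbinom q k j.+1.
  rewrite big_ord_recl subn0 qbinom0 mulr1; congr (_ + _).
  by rewrite [RHS]big_ord_recr /= qbinom_small // mulr0 addr0.
rewrite big_ord_recl /alSalamCarlitz_coef -/(a _) subn0 qbinom0 mulr1.
transitivity (a k.+1 + (\sum_(j < k.+1) a (k - j)%N * qbinom q k j.+1
  + \sum_(j < k.+1) a (k - j)%N * (q%:R ^+ (k - j) * qbinom q k j))).
  congr (_ + _); rewrite -big_split; apply: eq_bigr => j _ /=.
  by rewrite /bump add1n subSS -/(a _) qbinomS -1?ltnS //; ring.
rewrite addrA -second -big_split big1 // => j _ /=.
by rewrite subSn -1?ltnS // aS; ring.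
Qed.

End AlSalamCarlitzCoefficients.

(** * Counting linearly independent tuples in a subspace *)

Section FreeTuples.

Variables (F : finFieldType) (n : nat).

Implicit Types (A g x y : 'M[F]_n) (U : {vspace 'cV[F]_n}).

Definition free_tuples_in (t : nat) U : {set t.-tuple 'cV[F]_n} :=
  [set v : t.-tuple 'cV[F]_n | free v & all [in U] v].

(** A free t-tuple w in U is extended at its head by any vector of U outside the span of w, which
    has q^t elements. For t > dim U both sides are 0. *)
Lemma card_free_tuples_in t U :
  (#|free_tuples_in t U|%:R =
   \prod_(i < t) (#|F|%:R ^+ \dim U - #|F|%:R ^+ i) :> rat)%R.
Proof.
elim: t => [|t IHt].
  rewrite big_ord0 (_ : free_tuples_in 0 U = [set [tuple]]) ?cards1 //.
  by apply/setP => v; rewrite !inE tuple0 nil_free eqxx.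
rewrite big_ord_recr /= -IHt -[#|free_tuples_in t.+1 U|]sum1_card.
rewrite (partition_big (@behead_tuple t.+1 _) [in free_tuples_in t U])
  /=; last first.
  move=> v; rewrite !inE [v]tuple_eta /= free_cons.
  by move=> /andP[/andP[_ ->] /andP[_ ->]].
rewrite natr_sum mulr_natl -sumr_const; apply: eq_bigr => w w_in.
have := w_in; rewrite inE => /andP[free_w w_U].
have sub_wU : (<<w>> <= U)%VS by apply/span_subvP => u /(allP w_U).
have split_U : #|U| = (#|<<w>>%VS| + #|[predD U & <<w>>%VS]|)%N.
  rewrite -[LHS](cardID [in <<w>>%VS]); congr (_ + _).
  by apply: eq_card => u; rewrite !inE andb_idl // => /(subvP sub_wU).
have -> : (#|F|%:R ^+ \dim U - #|F|%:R ^+ t =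
           #|[predD U & <<w>>%VS]|%:R :> rat)%R.
  rewrite -!natrX -card_vspace split_U card_vspace (eqnP free_w) size_tuple.
  by rewrite natrD addrC addKr.
rewrite -sum1_card (reindex (fun u => [tuple of u :: w])) /=; last first.
  exists (@thead t _) => [u _|v]; first by rewrite theadE.
  by rewrite !inE => /andP[_ /eqP <-]; rewrite -tuple_eta.
congr (_%:R)%R; apply: eq_bigl => u; rewrite !inE /= free_cons free_w w_U.
rewrite !andbT; case: eqP => [_|[]]; first by rewrite andbT.
exact: val_inj.
Qed.

(** [kermx] consists of row vectors, so transposition matches the kernel on columns with [kermx] of
    the transpose. Comparing cardinalities, as powers of q, turns this bijection into an equality of
    dimensions. *)
Lemma dim_lker_mulmx A :
  \dim (lker (linfun (mulmx A : 'cV[F]_n -> 'cV[F]_n))) = n - \rank A.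
Proof.
have q_gt1 := finNzRing_gt1 F.
apply/eqP; rewrite -(eqn_exp2l _ _ q_gt1) -card_vspace.
rewrite -mxrank_tr -mxrank_ker -card_rowg.
rewrite -(card_imset (rowg _) (@trmx_inj _ _ _)).
apply/eqP; rewrite -[LHS]cardsE; apply: eq_card => v.
rewrite inE -[v in RHS]trmxK [RHS](mem_imset _ _ (@trmx_inj _ _ _)).
rewrite memv_ker lfunE inE; apply/eqP/sub_kermxP => [Av0|].
  by apply: trmx_inj; rewrite trmx_mul !trmxK trmx0 //.
by move/(congr1 trmx); rewrite trmx_mul !trmxK trmx0.
Qed.

End FreeTuples.

(** * Designs and the second moment of the transporter sizes *)

Section Designs.

Variables (F : finFieldType) (n : nat) (Y : {set 'M[F]_n}).
Hypothesis Y_GL : Y \subset unitmx.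

Local Notation act t g := (map_tuple (n := t) (mulmx g : 'cV[F]_n -> 'cV[F]_n)).

(** Its cardinality is N(v, w). *)
Definition transporter t (v w : t.-tuple 'cV[F]_n) : {set 'M[F]_n} :=
  [set g in Y | act t g v == w].

(** The number f_t. *)
Definition coincidences t : nat :=
  \sum_(x in Y) \sum_(y in Y)
    #|[set v : t.-tuple 'cV[F]_n | free v & act t x v == act t y v]|.

Lemma is_designE t :
  is_design t Y <-> exists r : nat, forall v w : t.-tuple 'cV[F]_n,
    free v -> free w -> #|transporter v w| = r.
Proof.
have E (v w : t.-tuple 'cV[F]_n) :
    [set g in Y | [forall i, (g *m tnth v i)%R == tnth w i]] = transporter v w.
  apply/setP => g; rewrite !inE; congr (_ && _); apply/forallP/eqP.
    by move=> gv; apply: eq_from_tnth => i; rewrite tnth_map; apply/eqP.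
  by move=> <- i; rewrite tnth_map.
by split=> -[r Hr]; exists r => v w /Hr H /H; rewrite E.
Qed.

Lemma span_act (g : 'M[F]_n) (u : 'cV[F]_n) (s : seq 'cV[F]_n) :
  g \in unitmx ->
  ((g *m u)%R \in <<[seq (g *m z)%R | z <- s]>>%VS) = (u \in <<s>>%VS).
Proof.
move=> g_unit; pose f := linfun (mulmx g : 'cV[F]_n -> 'cV[F]_n).
have inj_f : lker f == 0%VS.
  apply/lker0P => a b; rewrite !lfunE => /(congr1 (mulmx (invmx g))).
  by rewrite !mulKmx.
have -> : [seq (g *m z)%R | z <- s] = map f s.
  by apply: eq_map => z; rewrite lfunE.
rewrite -limg_span -[(g *m u)%R]/(mulmx g u) -(lfunE (mulmx g)) -/f.
by rewrite memvE -limg_line limg_ker0 // -memvE.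
Qed.

Lemma free_act t (g : 'M[F]_n) (v : t.-tuple 'cV[F]_n) :
  g \in unitmx -> free (act t g v) = free v.
Proof.
move=> g_unit; case: v => s /= _; elim: s => //= u s IHs.
by rewrite !free_cons span_act // IHs.
Qed.

Lemma sum_transporter t (v : t.-tuple 'cV[F]_n) :
  free v -> \sum_(w : t.-tuple 'cV[F]_n | free w) #|transporter v w| = #|Y|.
Proof.
move=> free_v; rewrite -[RHS]sum1_card.
rewrite (partition_big (fun g => act t g v) (fun w => free w)) /=.
  by apply: eq_bigr => w _; rewrite sum1dep_card.
by move=> g /(subsetP Y_GL) g_unit; rewrite free_act.
Qed.

(** N(v, w)^2 counts the pairs (x, y) with x v = w = y v; summing over w leaves the condition x v =
    y v. *)
Lemma sum_sqr_transporter t :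
  \sum_(v : t.-tuple 'cV[F]_n | free v) \sum_(w : t.-tuple 'cV[F]_n | free w)
     #|transporter v w| ^ 2 = coincidences t.
Proof.
transitivity (\sum_(v : t.-tuple 'cV[F]_n | free v)
    \sum_(x in Y) \sum_(y in Y) (act t x v == act t y v : nat)).
  apply: eq_bigr => v free_v.
  rewrite [RHS](partition_big (fun g => act t g v) (fun w => free w)) /=.
    apply: eq_bigr => w _; rewrite expnS expn1.
    transitivity (\sum_(x in transporter v w) #|transporter v w|).
      by rewrite sum_nat_const.
    apply: eq_big => [x|x]; rewrite inE // => /andP[_ /eqP xv].
    rewrite -sum1_card big_mkcond [RHS]big_mkcond; apply: eq_bigr => y _.
    by rewrite inE xv eq_sym; case: (y \in Y) => //=; case: eqP.
  by move=> g /(subsetP Y_GL) g_unit; rewrite free_act.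
rewrite exchange_big; apply: eq_bigr => x _ /=.
rewrite exchange_big; apply: eq_bigr => y _ /=.
rewrite -sum1dep_card big_mkcondr; apply: eq_bigr => v _.
by case: eqP.
Qed.

Local Notation nfree t := #|[set v : t.-tuple 'cV[F]_n | free v]|.

Local Open Scope ring_scope.

(** Expand the square; for each v the cross term is evaluated by [sum_transporter]. Scaling the
    deviation from the mean |Y| / I by I avoids any division. *)
Lemma transporter_variance t :
  \sum_(v : t.-tuple 'cV[F]_n | free v) \sum_(w : t.-tuple 'cV[F]_n | free w)
     (#|transporter v w|%:R * (nfree t)%:R - #|Y|%:R) ^+ 2 =
  (nfree t)%:R ^+ 2 * ((coincidences t)%:R - #|Y|%:R ^+ 2) :> rat.
Proof.
set I : rat := (nfree t)%:R; set y : rat := #|Y|%:R.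
have sumc (c : rat) : \sum_(v : t.-tuple 'cV[F]_n | free v) c = I * c.
  by rewrite sumr_const -mulr_natl /I cardsE.
have -> : (coincidences t)%:R = \sum_(v : t.-tuple 'cV[F]_n | free v)
    \sum_(w : t.-tuple 'cV[F]_n | free w) #|transporter v w|%:R ^+ 2 :> rat.
  rewrite -sum_sqr_transporter natr_sum; apply: eq_bigr => v _.
  by rewrite natr_sum; apply: eq_bigr => w _; rewrite natrX.
transitivity (\sum_(v : t.-tuple 'cV[F]_n | free v)
  (I ^+ 2 * (\sum_(w : t.-tuple 'cV[F]_n | free w) #|transporter v w|%:R ^+ 2)
   - I * y ^+ 2)); last first.
  by rewrite big_split /= -mulr_sumr sumc; ring.
apply: eq_bigr => v free_v.
have sumN : \sum_(w : t.-tuple 'cV[F]_n | free w) #|transporter v w|%:R = y.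
  by rewrite -natr_sum sum_transporter.
transitivity (I ^+ 2 * (\sum_(w : t.-tuple 'cV[F]_n | free w)
    #|transporter v w|%:R ^+ 2)
  - 2 * I * y * (\sum_(w : t.-tuple 'cV[F]_n | free w) #|transporter v w|%:R)
  + \sum_(w : t.-tuple 'cV[F]_n | free w) y ^+ 2); last first.
  by rewrite sumN sumc; ring.
rewrite !mulr_sumr -sumrB -big_split; apply: eq_bigr => w _ /=.
by ring.
Qed.

Lemma nfree_neq0 t : (t <= n)%N -> (nfree t)%:R != 0 :> rat.
Proof.
move=> le_tn.
have -> : [set v : t.-tuple 'cV[F]_n | free v] = free_tuples_in t fullv.
  by apply/setP => v; rewrite !inE; apply/esym/andb_idr => _;
    apply/allP => u _; rewrite memvf.
rewrite card_free_tuples_in dimvf /dim /= muln1.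
apply/prodf_neq0 => i _; apply: subr_expq_neq0; first exact: finNzRing_gt1.
exact: leq_trans le_tn.
Qed.

Lemma is_design_coincidences t : (t <= n)%N ->
  is_design t Y <-> (coincidences t)%:R = #|Y|%:R ^+ 2 :> rat.
Proof.
move=> le_tn; have I0 := nfree_neq0 le_tn; have var := transporter_variance t.
rewrite is_designE; split=> [[r Hr]|Hc].
  (* If N is constantly r, summing over w gives I r = |Y|, so every deviation is 0. *)
  apply/subr0_eq/(mulfI (expf_neq0 2 I0)); rewrite mulr0 -var.
  rewrite big1 // => v free_v; rewrite big1 // => w free_w.
  rewrite Hr // mulrC -(sum_transporter free_v).
  under eq_bigr do rewrite Hr //.
  by rewrite sum_nat_cond_const natrM subrr expr0n.
(* The common value is |Y| / I. Taking a maximum produces it as a natural number without a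
   divisibility argument. *)
exists (\max_(v : t.-tuple 'cV[F]_n | free v)
  \max_(w : t.-tuple 'cV[F]_n | free w) #|transporter v w|)%N.
have N_const (v w : t.-tuple 'cV[F]_n) : free v -> free w ->
    #|transporter v w|%:R = #|Y|%:R / (nfree t)%:R :> rat.
  move=> free_v free_w; apply: (canRL (mulfK I0)); apply/eqP.
  rewrite Hc subrr mulr0 in var; rewrite -subr_eq0 -sqrf_eq0; apply/eqP.
  move: w free_w; apply: psumr_eq0P => [w _|]; first exact: sqr_ge0.
  move: v free_v; apply: psumr_eq0P => [v _|//].
  by apply: sumr_ge0 => w _; exact: sqr_ge0.
move=> v w free_v free_w; apply/eqP; rewrite eqn_leq; apply/andP; split.
  apply: leq_trans (leq_bigmax_cond _ free_v).
  exact: (leq_bigmax_cond (F := fun w => #|transporter v w|)).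
apply/bigmax_leqP => v' free_v'; apply/bigmax_leqP => w' free_w'.
by rewrite -(ler_nat rat) !N_const.
Qed.

Local Close Scope ring_scope.

Lemma is_design_pred t : t < n -> is_design t.+1 Y -> is_design t Y.
Proof.
move=> lt_tn /is_designE[r Hr]; apply/is_designE.
(* An extra vector outside the span of v must be sent outside the span of w: there are q^n - q^t
   possible images, each attained by r elements of Y. *)
exists ((#|{: 'cV[F]_n}| - #|F| ^ t) * r) => v w free_v free_w.
have [u u_v] : exists u, u \notin <<v>>%VS.
  apply/existsP; rewrite -negb_forall; apply/negP => /forallP all_v.
  have /eqP := card_vspace <<v>>; rewrite (eqnP free_v) size_tuple.
  rewrite (eq_card (B := 'cV[F]_n)) => [|z]; last by rewrite all_v.
  rewrite card_mx muln1 eqn_exp2l ?finNzRing_gt1 //.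
  by rewrite gtn_eqF.
have free_uv : free [tuple of u :: v] by rewrite free_cons u_v.
(* Split the g mapping v to w according to the image z of the extra vector u. *)
transitivity (\sum_(z : 'cV[F]_n)
    #|transporter [tuple of u :: v] [tuple of z :: w]|).
  rewrite -sum1_card (partition_big (fun g => mulmx g u) xpredT) //=.
  apply: eq_bigr => z _; rewrite sum1dep_card; apply: eq_card => g.
  by rewrite !inE -!val_eqE /= eqseq_cons andbA andbAC -andbA andbCA andbA.
rewrite (bigID (fun z => z \in <<w>>%VS)) /= big1 => [|z z_w]; last first.
  apply/eqP; rewrite cards_eq0 -subset0; apply/subsetP => g.
  rewrite inE => /andP[/(subsetP Y_GL) g_unit /eqP gE].
  by have := free_act [tuple of u :: v] g_unit; rewrite gE free_uv free_cons z_w.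
rewrite add0n (eq_bigr (fun=> r)) => [|z z_w]; last first.
  by apply: Hr => //; rewrite free_cons z_w.
rewrite sum_nat_cond_const; congr (_ * _).
rewrite -(cardC [in <<w>>%VS]) card_vspace (eqnP free_w) size_tuple addKn.
by rewrite cardsE; apply: eq_card => z; rewrite !inE.
Qed.

Lemma is_design_le s t : s <= t -> t <= n -> is_design t Y -> is_design s Y.
Proof.
move=> le_st; elim: t le_st => [|t IHt]; first by rewrite leqn0 => /eqP ->.
rewrite leq_eqVlt => /orP[/eqP -> //|le_st] lt_tn /is_design_pred H.
by apply: IHt => //; [exact: ltnW | exact: H].
Qed.

(** * From coincidences to the dual distance distribution *)

Lemma coincidencesE t :
  ((coincidences t)%:R = \sum_(x in Y) \sum_(y in Y)
    \prod_(i < t) (#|F|%:R ^+ (n - \rank (x - y)) - #|F|%:R ^+ i) :> rat)%R.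
Proof.
rewrite natr_sum; apply: eq_bigr => x _; rewrite natr_sum.
apply: eq_bigr => y _; rewrite -dim_lker_mulmx -card_free_tuples_in.
congr (_%:R)%R; apply: eq_card => v; rewrite !inE; congr (_ && _).
apply/eqP/allP => [/(congr1 val) /= xy u u_v|xy].
  rewrite memv_ker lfunE /= mulmxBl subr_eq0; apply/eqP.
  exact: (eq_in_map _ _ _).2 xy u u_v.
apply: val_inj; apply/eq_in_map => u /xy.
by rewrite memv_ker lfunE /= mulmxBl subr_eq0 => /eqP.
Qed.

(** Both sides are the sum of U_k(q^(n - rk (x - y))) over all pairs: group the pairs by rank, or
    expand U_k and exchange the sums. *)
Lemma dual_distance_distributionE k : Y != set0 ->
  (#|Y|%:R * dual_distance_distribution Y k =
   \sum_(j < k.+1) alSalamCarlitz_coef #|F| k j * (coincidences j)%:R :> rat)%R.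
Proof.
rewrite -card_gt0 => Y_gt0.
have Y0 : (#|Y|%:R != 0 :> rat)%R by rewrite pnatr_eq0 -lt0n.
pose P := alSalamCarlitz #|F| k.
transitivity (\sum_(x in Y) \sum_(y in Y)
    P.[#|F|%:R ^+ (n - \rank (x - y))] : rat)%R; last first.
  under [RHS]eq_bigr do rewrite coincidencesE mulr_sumr.
  rewrite [RHS]exchange_big; apply: eq_bigr => x _ /=.
  under [RHS]eq_bigr do rewrite mulr_sumr.
  rewrite [RHS]exchange_big; apply: eq_bigr => y _ /=.
  rewrite /P /alSalamCarlitz horner_sum; apply: eq_bigr => j _.
  rewrite hornerZ horner_prod; congr (_ * _)%R.
  by apply: eq_bigr => i _; rewrite !hornerE.
rewrite pair_big /= (partition_big
  (fun p => Ordinal (rank_leq_row (p.1 - p.2)%R : _ < n.+1)) xpredT) //=.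
rewrite /dual_distance_distribution mulr_sumr; apply: eq_bigr => i _.
rewrite mulrCA [(#|Y|%:R * _)%R]mulrC divfK // mulr_natr -sumr_const.
apply: eq_big => [p|p]; first by rewrite !inE -val_eqE.
by rewrite !inE => /andP[_ /eqP <-].
Qed.

End Designs.

Theorem proposition7p4 (F : finFieldType) (n t : nat) (Y : {set 'M[F]_n})
    (n_gt0 : 0 < n) (Y_GL : Y \subset unitmx) (Y_neq0 : Y != set0)
    (t_gt0 : 0 < t) (le_tn : t <= n) :
  (is_design t Y ->
     forall k : nat, 1 <= k <= t -> dual_distance_distribution Y k = 0%R)
  /\
  (t.*2 <= n ->
     (forall k : nat, 1 <= k <= t -> dual_distance_distribution Y k = 0%R) ->
     is_design t Y).
Proof.
have q_gt1 := finNzRing_gt1 F.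
have Y0 : (#|Y|%:R != 0 :> rat)%R by rewrite pnatr_eq0 -lt0n card_gt0.
(* To be used with c = |Y|^2, the value expected of every f_j. *)
have sum0 k (c : rat) :
    (\sum_(j < k.+2) alSalamCarlitz_coef #|F| k.+1 j * c = 0)%R.
  by rewrite -mulr_suml sum_alSalamCarlitz_coef ?mul0r.
split=> [des [//|k] /andP[_ le_kt]|_ dual0].
  apply: (mulfI Y0); rewrite mulr0 dual_distance_distributionE //.
  rewrite -[RHS](sum0 k (#|Y|%:R ^+ 2)%R); apply: eq_bigr => j _.
  have le_jt : j <= t by apply: leq_trans le_kt; rewrite -ltnS.
  have /is_design_coincidences -> // := is_design_le Y_GL le_jt le_tn des.
  exact: leq_trans le_tn.
apply/is_design_coincidences => //.
(* Strong induction solves the triangular system. It starts at f_0 = |Y|^2, where the products are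
   empty. *)
elim/ltn_ind: t {t_gt0 le_tn} dual0 => -[_ _|k IHk dual0].
  rewrite coincidencesE expr2 mulr_natl -[RHS]sumr_const.
  apply: eq_bigr => x _; rewrite -[RHS]sumr_const.
  by apply: eq_bigr => y _; rewrite big_ord0.
have low : (\sum_(j < k.+1) alSalamCarlitz_coef #|F| k.+1 j * (coincidences Y j)%:R
    = \sum_(j < k.+1) alSalamCarlitz_coef #|F| k.+1 j * #|Y|%:R ^+ 2 :> rat)%R.
  apply: eq_bigr => j _; rewrite IHk // => i /andP[i_gt0 le_ij].
  by apply: dual0; rewrite i_gt0 ltnW // (leq_ltn_trans le_ij).
have : (\sum_(j < k.+2) alSalamCarlitz_coef #|F| k.+1 j * (coincidences Y j)%:R
    = \sum_(j < k.+2) alSalamCarlitz_coef #|F| k.+1 j * #|Y|%:R ^+ 2 :> rat)%R.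
  by rewrite sum0 -dual_distance_distributionE // dual0 ?mulr0 ?leqnn.
(* The lower terms agree and the diagonal coefficient is 1, so the top terms agree too. *)
rewrite big_ord_recr [X in _ = X]big_ord_recr /= low.
by rewrite /alSalamCarlitz_coef subnn qbinomnn // !mul1r => /addrI.
Qed.
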